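(* Let $b=b_1\mathbf i+b_2\mathbf j+b_3\mathbf k\ne0$ and $c=c_0+c_1\mathbf i+c_2\mathbf j+c_3\mathbf k\in\mathbb H_s$, and put $B=2\langle 1,c\rangle+I_b$, $E=I_c$, $D=2\langle b,c\rangle$. If the equation $x^2+bx+c=0$ is solvable in $\mathbb H_s$ and has a solution $x=x_0+x_1\mathbf i+x_2\mathbf j+x_3\mathbf k$ with $x_0^2\neq\frac{M_b}{4}$, then $$x=(T+b)^{-1}(N-c),$$ where $(T,N)$ is chosen as follows: (1) $T=0$, $N=\frac{B\pm\sqrt{B^2-4E}}{2}$, provided $D=0$, $B^2-4E\ge0$; (2) $T=\pm\sqrt{-2\sqrt E-B}$, $N=-\sqrt E$, and $T=\pm\sqrt{2\sqrt E-B}$, $N=\sqrt E$, provided $D=0$, $E\ge0$, $-2\sqrt E-B\ge0$; (3) $T=\pm\sqrt{2\sqrt E-B}$, $N=\sqrt E$, provided $D=0$, $E>0$, $2\sqrt E-B\ge0>-2\sqrt E-B$; (4) $T=\pm\sqrt z$, $N=\frac{T^3+BT+D}{2T}$, provided $D\ne0$, Case 1 holds, and $z$ is the unique positive root of the real polynomial $z^3+2Bz^2+(B^2-4E)z-D^2$; (5) $T=\pm\sqrt{z_i}$, $N=\frac{T^3+BT+D}{2T}$, $i=1,2$, provided $D\ne0$, Case 2 holds, and $z_1,z_2$ are the two positive roots of $z^3+2Bz^2+(B^2-4E)z-D^2$; (6) $T=\pm\sqrt{z_i}$, $N=\frac{T^3+BT+D}{2T}$, $i=1,2,3$, provided $D\neq0$,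 Case 3 holds, and $z_1,z_2,z_3$ are the three positive roots of $z^3+2Bz^2+(B^2-4E)z-D^2$. Here, with $F_1=\frac{-2B^3+2(B^2+12E)^{3/2}}{27}+\frac{8EB}{3}-D^2$ and $F_2=\frac{-2B^3-2(B^2+12E)^{3/2}}{27}+\frac{8EB}{3}-D^2$: Case 1 means that one of the following holds: (i) $B^2+12E\le0$; (ii) $B^2+12E>0$, $B\ge0$; (iii) $B<0$, $B^2-4E<0$; (iv) $B^2+12E>0$, $B<0$, $B^2-4E>0$, $F_1<0$; (v) $B^2+12E>0$, $B<0$, $B^2-4E>0$, $F_2>0$. Case 2 means that one of the following holds: (vi) $B^2+12E>0$, $B<0$, $B^2-4E>0$, $F_1=0$; (vii) $B^2+12E>0$, $B<0$, $B^2-4E>0$, $F_2=0$. Case 3 means $B^2+12E>0$, $B<0$, $B^2-4E>0$, $F_1>0>F_2$.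
   Context: $\mathbb H_s$ is the split quaternion algebra: the 4-dimensional associative real algebra with basis $1,\mathbf i,\mathbf j,\mathbf k$ and $\mathbf i^2=-1$, $\mathbf j^2=\mathbf k^2=1$, $\mathbf i\mathbf j=\mathbf k=-\mathbf j\mathbf i$, $\mathbf j\mathbf k=-\mathbf i=-\mathbf k\mathbf j$, $\mathbf k\mathbf i=\mathbf j=-\mathbf i\mathbf k$. For $x=x_0+x_1\mathbf i+x_2\mathbf j+x_3\mathbf k$ and $y=y_0+y_1\mathbf i+y_2\mathbf j+y_3\mathbf k$ with real coefficients: $\bar x=x_0-x_1\mathbf i-x_2\mathbf j-x_3\mathbf k$, $\langle x,y\rangle=x_0y_0+x_1y_1-x_2y_2-x_3y_3$, $I_x=\langle x,x\rangle=\bar xx$, $M_x=-x_1^2+x_2^2+x_3^2$. An element $x$ is invertible iff $I_x\ne0$, and then $x^{-1}=\bar x/I_x$. *)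

(* Defs.v *)
From HB Require Import structures.
From mathcomp Require Import all_boot all_order all_algebra.
From mathcomp Require Import ring.
From mathcomp Require Import reals exp.
Set Implicit Arguments.
Unset Strict Implicit.
Unset Printing Implicit Defensive.
Import Order.TTheory GRing.Theory Num.Theory.
Local Open Scope ring_scope.

(** [SplitQuat a0 a1 a2 a3] stands for a0 + a1 i + a2 j + a3 k. *)
Record split_quat (R : realType) :=
  SplitQuat { sq0 : R; sq1 : R; sq2 : R; sq3 : R }.

Section SplitQuaternions.
Variable R : realType.
Local Notation H := (split_quat R).
Implicit Types x y z : H.

Lemma sq_ext x y : sq0 x = sq0 y -> sq1 x = sq1 y -> sq2 x = sq2 y ->
  sq3 x = sq3 y -> x = y.
Proof. by case: x => a0 a1 a2 a3; case: y => b0 b1 b2 b3 /= -> -> -> ->. Qed.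

Definition sq_to_prod x : R * R * R * R := (sq0 x, sq1 x, sq2 x, sq3 x).
Definition sq_of_prod (p : R * R * R * R) : H :=
  SplitQuat p.1.1.1 p.1.1.2 p.1.2 p.2.
Lemma sq_to_prodK : cancel sq_to_prod sq_of_prod.
Proof. by case. Qed.
HB.instance Definition _ := Choice.copy H (can_type sq_to_prodK).

Definition sq_add x y : H :=
  SplitQuat (sq0 x + sq0 y) (sq1 x + sq1 y) (sq2 x + sq2 y) (sq3 x + sq3 y).
Definition sq_opp x : H := SplitQuat (- sq0 x) (- sq1 x) (- sq2 x) (- sq3 x).
Definition sq_zero : H := SplitQuat 0 0 0 0.
Definition sq_one : H := SplitQuat 1 0 0 0.
Definition sq_scale (a : R) x : H :=
  SplitQuat (a * sq0 x) (a * sq1 x) (a * sq2 x) (a * sq3 x).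

(** The bilinear product determined by i^2 = -1, j^2 = k^2 = 1,
    ij = k = -ji, jk = -i = -kj, ki = j = -ik; see [sq_mul_table]. *)
Definition sq_mul x y : H :=
  SplitQuat
    (sq0 x * sq0 y - sq1 x * sq1 y + sq2 x * sq2 y + sq3 x * sq3 y)
    (sq0 x * sq1 y + sq1 x * sq0 y - sq2 x * sq3 y + sq3 x * sq2 y)
    (sq0 x * sq2 y + sq2 x * sq0 y - sq1 x * sq3 y + sq3 x * sq1 y)
    (sq0 x * sq3 y + sq3 x * sq0 y + sq1 x * sq2 y - sq2 x * sq1 y).

Lemma sq_addA : associative sq_add.
Proof. by move=> x y z; apply: sq_ext => /=; ring. Qed.
Lemma sq_addC : commutative sq_add.
Proof. by move=> x y; apply: sq_ext => /=; ring. Qed.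
Lemma sq_add0 : left_id sq_zero sq_add.
Proof. by move=> x; apply: sq_ext => /=; ring. Qed.
Lemma sq_addN : left_inverse sq_zero sq_opp sq_add.
Proof. by move=> x; apply: sq_ext => /=; ring. Qed.
HB.instance Definition _ :=
  GRing.isZmodule.Build H sq_addA sq_addC sq_add0 sq_addN.

Lemma sq_mulA : associative sq_mul.
Proof. by move=> x y z; apply: sq_ext => /=; ring. Qed.
Lemma sq_mul1l : left_id sq_one sq_mul.
Proof. by move=> x; apply: sq_ext => /=; ring. Qed.
Lemma sq_mul1r : right_id sq_one sq_mul.
Proof. by move=> x; apply: sq_ext => /=; ring. Qed.
Lemma sq_mulDl : left_distributive sq_mul +%R.
Proof. by move=> x y z; apply: sq_ext => /=; ring. Qed.
Lemma sq_mulDr : right_distributive sq_mul +%R.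
Proof. by move=> x y z; apply: sq_ext => /=; ring. Qed.
Lemma sq_one_neq0 : sq_one != 0.
Proof. by apply/eqP => -[] /eqP; rewrite oner_eq0. Qed.
HB.instance Definition _ := GRing.Zmodule_isNzRing.Build H
  sq_mulA sq_mul1l sq_mul1r sq_mulDl sq_mulDr sq_one_neq0.

Lemma sq_scaleA (a b : R) x : sq_scale a (sq_scale b x) = sq_scale (a * b) x.
Proof. by apply: sq_ext => /=; ring. Qed.
Lemma sq_scale1 : left_id 1 sq_scale.
Proof. by move=> x; apply: sq_ext => /=; ring. Qed.
Lemma sq_scaleDr : right_distributive sq_scale +%R.
Proof. by move=> a x y; apply: sq_ext => /=; ring. Qed.
Lemma sq_scaleDl x : {morph sq_scale^~ x : a b / a + b}.
Proof. by move=> a b; apply: sq_ext => /=; ring. Qed.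
HB.instance Definition _ := GRing.Zmodule_isLmodule.Build R H
  sq_scaleA sq_scale1 sq_scaleDr sq_scaleDl.

Lemma sq_scaleAl (a : R) x y : a *: (x * y) = a *: x * y.
Proof. by apply: sq_ext => /=; ring. Qed.
HB.instance Definition _ := GRing.Lmodule_isLalgebra.Build R H sq_scaleAl.

Lemma sq_scaleAr (a : R) x y : a *: (x * y) = x * (a *: y).
Proof. by apply: sq_ext => /=; ring. Qed.
HB.instance Definition _ := GRing.Lalgebra_isAlgebra.Build R H sq_scaleAr.

Definition sq_i : H := SplitQuat 0 1 0 0.
Definition sq_j : H := SplitQuat 0 0 1 0.
Definition sq_k : H := SplitQuat 0 0 0 1.

Lemma sq_decomp x :
  x = (sq0 x)%:A + sq1 x *: sq_i + sq2 x *: sq_j + sq3 x *: sq_k.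
Proof. by apply: sq_ext => /=; ring. Qed.

Lemma sq_mul_table :
  [/\ sq_i ^+ 2 = -1, sq_j ^+ 2 = 1 & sq_k ^+ 2 = 1] /\
  [/\ sq_i * sq_j = sq_k /\ sq_j * sq_i = - sq_k,
      sq_j * sq_k = - sq_i /\ sq_k * sq_j = sq_i
    & sq_k * sq_i = sq_j /\ sq_i * sq_k = - sq_j].
Proof. by do !split; rewrite ?expr2; apply: sq_ext => /=; ring. Qed.

Definition sq_conj x : H := SplitQuat (sq0 x) (- sq1 x) (- sq2 x) (- sq3 x).

Definition sq_dot x y : R :=
  sq0 x * sq0 y + sq1 x * sq1 y - sq2 x * sq2 y - sq3 x * sq3 y.

(** [sq_I x] is the indefinite quadratic form I_x (not a norm). *)
Definition sq_I x : R := sq_dot x x.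

Definition sq_M x : R := - sq1 x ^+ 2 + sq2 x ^+ 2 + sq3 x ^+ 2.

Lemma sq_conj_mul x : sq_conj x * x = (sq_I x)%:A.
Proof. by apply: sq_ext; rewrite /sq_I /sq_dot /=; ring. Qed.

Lemma sq_mul_conj x : x * sq_conj x = (sq_I x)%:A.
Proof. by apply: sq_ext; rewrite /sq_I /sq_dot /=; ring. Qed.

Lemma sq_IM x y : sq_I (x * y) = sq_I x * sq_I y.
Proof. by rewrite /sq_I /sq_dot /=; ring. Qed.

(** As usual for unit rings, the inverse is the identity off the units. *)
Definition sq_unit : pred H := [pred x | sq_I x != 0].
Definition sq_inv x : H :=
  if sq_I x != 0 then (sq_I x)^-1 *: sq_conj x else x.

Lemma sq_mulVr : {in sq_unit, left_inverse 1 sq_inv *%R}.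
Proof.
move=> x; rewrite inE /sq_inv => hx; rewrite hx.
by rewrite -scalerAl sq_conj_mul scalerA mulVf // scale1r.
Qed.
Lemma sq_mulrV : {in sq_unit, right_inverse 1 sq_inv *%R}.
Proof.
move=> x; rewrite inE /sq_inv => hx; rewrite hx.
by rewrite -scalerAr sq_mul_conj scalerA mulVf // scale1r.
Qed.
Lemma sq_unitP x y : y * x = 1 /\ x * y = 1 -> sq_unit x.
Proof.
case=> yx _; rewrite /sq_unit /=; apply/eqP => x0.
have: sq_I (y * x) = 1 by rewrite yx /sq_I /sq_dot /=; ring.
by rewrite sq_IM x0 mulr0 => /esym/eqP; rewrite oner_eq0.
Qed.
Lemma sq_inv_out : {in [predC sq_unit], sq_inv =1 id}.
Proof. by move=> x; rewrite !inE /sq_inv => /negbTE ->. Qed.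
HB.instance Definition _ := GRing.NzRing_hasMulInverse.Build H
  sq_mulVr sq_mulrV sq_unitP sq_inv_out.

End SplitQuaternions.

Section ResolventCubic.
Variable R : realType.
Implicit Types (B E D : R) (p : {poly R}) (s : seq R).

Definition resolvent B E D : {poly R} :=
  'X^3 + (2 * B) *: 'X^2 + (B ^+ 2 - 4 * E) *: 'X - (D ^+ 2)%:P.

(** [s] lists the positive roots of [p], each exactly once. *)
Definition positive_roots p s : Prop :=
  uniq s /\ forall w : R, (w \in s) = (0 < w) && root p w.

Definition F1 B E D : R :=
  (- 2 * B ^+ 3 + 2 * (B ^+ 2 + 12 * E) `^ (3 / 2)) / 27
  + 8 * E * B / 3 - D ^+ 2.

Definition F2 B E D : R :=
  (- 2 * B ^+ 3 - 2 * (B ^+ 2 + 12 * E) `^ (3 / 2)) / 27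
  + 8 * E * B / 3 - D ^+ 2.

Definition Case1 B E D : Prop :=
  B ^+ 2 + 12 * E <= 0
  \/ [/\ 0 < B ^+ 2 + 12 * E & 0 <= B]
  \/ [/\ B < 0 & B ^+ 2 - 4 * E < 0]
  \/ [/\ 0 < B ^+ 2 + 12 * E, B < 0, 0 < B ^+ 2 - 4 * E & F1 B E D < 0]
  \/ [/\ 0 < B ^+ 2 + 12 * E, B < 0, 0 < B ^+ 2 - 4 * E & 0 < F2 B E D].

Definition Case2 B E D : Prop :=
  [/\ 0 < B ^+ 2 + 12 * E, B < 0, 0 < B ^+ 2 - 4 * E & F1 B E D = 0]
  \/ [/\ 0 < B ^+ 2 + 12 * E, B < 0, 0 < B ^+ 2 - 4 * E & F2 B E D = 0].

Definition Case3 B E D : Prop :=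
  [/\ 0 < B ^+ 2 + 12 * E, B < 0, 0 < B ^+ 2 - 4 * E
    & F2 B E D < 0 < F1 B E D].

End ResolventCubic.

(* Main.v *)
Require Import Defs.
From mathcomp Require Import all_boot all_order all_algebra.
From mathcomp Require Import reals exp.
From mathcomp Require Import ring lra.
Set Implicit Arguments.
Unset Strict Implicit.
Unset Printing Implicit Defensive.
Import Order.TTheory GRing.Theory Num.Theory.
Local Open Scope ring_scope.

(** Every split quaternion is a root of its characteristic polynomial:
    [x ^+ 2 = T *: x - N%:A] with the trace [T = 2 * sq0 x] and the norm
    [N = sq_I x].  Substituting this into the equation makes it linear in [x],
    [(T%:A + b) * x = N%:A - c], and the condition on [sq0 x] says exactly that
    the coefficient [T%:A + b], whose norm is [T ^+ 2 - sq_M b], is invertible.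
    So only [T] and [N] have to be found.  Taking norms on both sides of the
    linear equation, and then the inner product of both sides with [T%:A + b],
    gives the real system ([trace_norm_system])
      N^2 - (B + T^2) N + E = 0   and   T^3 + (B - 2 N) T + D = 0.

    If [D = 0], the second equation says [T = 0] or [T^2 = 2 N - B]; the first
    one then becomes [N^2 - B N + E = 0], respectively [N^2 = E]
    ([system_degenerate]).  If [D != 0], then [T != 0], the second equation
    gives [N], and eliminating [N] from the first shows that [T^2] is a positive
    root of the resolvent cubic ([system_resolvent]).

    It remains to count the positive roots of the cubic.  One of them,
    [z = T^2], is at hand, so no existence argument is required: dividing by
    ['X - z] leaves [w^2 + p w + q] with [p = 2 B + z] and [q = D^2 / z > 0],
    whose two real roots, if any, have the same sign.  [F1] and [F2] are the
    values of the cubic at its local maximum and minimum, and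
      27 F1 F2 = - (p^2 - 4 q) (z^2 + p z + q)^2
    is minus the discriminant ([F1F2_discriminant]).  The signs of [F1] and [F2]
    therefore decide whether the other two roots are real, and whether two of
    the three roots coincide. *)

(** * The real system for trace and norm *)

Section TraceNorm.
Variable R : realType.
Implicit Types b c u x : split_quat R.

Lemma sq_cayley x : x ^+ 2 = (2 * sq0 x) *: x - (sq_I x)%:A.
Proof. by rewrite expr2; apply: sq_ext; rewrite /sq_I /sq_dot /=; ring. Qed.

(** [sq_dot u y] is the real part of [sq_conj u * y], and
    [sq_conj u * u] is the scalar [sq_I u]. *)
Lemma sq_dot_mull u x : sq_dot u (u * x) = sq_I u * sq0 x.
Proof. by rewrite /sq_I /sq_dot /=; ring. Qed.

Lemma sq_I_add_pure (t : R) b : sq0 b = 0 -> sq_I (t%:A + b) = t ^+ 2 - sq_M b.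
Proof. by move=> b0; rewrite /sq_I /sq_dot /sq_M /= b0; ring. Qed.

Lemma sq_linearized b c x : x ^+ 2 + b * x + c = 0 ->
  ((2 * sq0 x)%:A + b) * x = (sq_I x)%:A - c.
Proof.
move=> /eqP; rewrite addr_eq0 sq_cayley => /eqP <-.
by rewrite mulrDl mulr_algl addrA addrCA subrr addr0.
Qed.

Lemma trace_norm_system b c x : sq0 b = 0 -> x ^+ 2 + b * x + c = 0 ->
  let T := 2 * sq0 x in let N := sq_I x in
  N ^+ 2 - (2 * sq_dot 1 c + sq_I b + T ^+ 2) * N + sq_I c = 0 /\
  T ^+ 3 + (2 * sq_dot 1 c + sq_I b - 2 * N) * T + 2 * sq_dot b c = 0.
Proof.
move=> b0 /sq_linearized lin T N.
have normE : sq_I (T%:A + b) * N = sq_I (N%:A - c) by rewrite -lin sq_IM.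
have dotE : sq_I (T%:A + b) * sq0 x = sq_dot (T%:A + b) (N%:A - c).
  by rewrite -lin sq_dot_mull.
have TE : sq0 x = T / 2 by rewrite /T; field.
move: normE dotE; rewrite TE; move: T N {lin TE} => T N.
rewrite /sq_I /sq_dot /= b0 => normE dotE.
by split; lra.
Qed.

End TraceNorm.

(** * Solving the system *)

Section System.
Variable R : realType.
Implicit Types B E D T N z : R.

Lemma sqr_eq_sqrt T z : T ^+ 2 = z -> T = Num.sqrt z \/ T = - Num.sqrt z.
Proof.
move=> <-; rewrite sqrtr_sqr.
by case: (ger0P T) => _; [left | right; rewrite opprK].
Qed.

Lemma system_degenerate B E T N :
    N ^+ 2 - (B + T ^+ 2) * N + E = 0 -> T ^+ 3 + (B - 2 * N) * T = 0 ->
  [\/ [/\ 0 <= B ^+ 2 - 4 * E, T = 0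
        & N = (B + Num.sqrt (B ^+ 2 - 4 * E)) / 2 \/
          N = (B - Num.sqrt (B ^+ 2 - 4 * E)) / 2],
      [/\ 0 <= E, 0 <= - 2 * Num.sqrt E - B
        & ((T = Num.sqrt (- 2 * Num.sqrt E - B) \/
            T = - Num.sqrt (- 2 * Num.sqrt E - B)) /\
           N = - Num.sqrt E) \/
          ((T = Num.sqrt (2 * Num.sqrt E - B) \/
            T = - Num.sqrt (2 * Num.sqrt E - B)) /\
           N = Num.sqrt E)]
    | [/\ 0 < E, 0 <= 2 * Num.sqrt E - B,
          - 2 * Num.sqrt E - B < 0
        & (T = Num.sqrt (2 * Num.sqrt E - B) \/
           T = - Num.sqrt (2 * Num.sqrt E - B)) /\
          N = Num.sqrt E]].
Proof.
move=> eqN eqT.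
have [T0|Tn0] := eqVneq T 0.
  constructor 1; rewrite T0 in eqN.
  have sqE : (2 * N - B) ^+ 2 = B ^+ 2 - 4 * E by lra.
  split=> //; first by rewrite -sqE sqr_ge0.
  by case: (sqr_eq_sqrt sqE) => eqS; [left | right]; lra.
have T2 : T ^+ 2 = 2 * N - B by apply: (mulfI Tn0); lra.
have N2 : N ^+ 2 = E by rewrite T2 in eqN; lra.
have E_ge0 : 0 <= E by rewrite -N2 sqr_ge0.
have T2_ge0 : 0 <= 2 * N - B by rewrite -T2 sqr_ge0.
have [NE|NE] := sqr_eq_sqrt N2; last first.
  rewrite NE in T2 T2_ge0; constructor 2; split=> //; first by lra.
  by left; split=> //; apply: sqr_eq_sqrt; lra.
rewrite NE in T2 T2_ge0; have TE := sqr_eq_sqrt T2.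
have [lt0|ge0] := ltP (- 2 * Num.sqrt E - B) 0; last first.
  by constructor 2; split=> //; right.
constructor 3; split=> //; rewrite lt_neqAle E_ge0 andbT eq_sym.
(* at E = 0 the two inequalities say B <= 0 < B *)
by apply/eqP => E0; rewrite E0 sqrtr0 in lt0 T2_ge0; lra.
Qed.

Lemma root_resolvent B E D z : root (resolvent B E D) z =
  (z ^+ 3 + 2 * B * z ^+ 2 + (B ^+ 2 - 4 * E) * z - D ^+ 2 == 0).
Proof. by rewrite rootE /resolvent !hornerE. Qed.

Lemma system_resolvent B E D T N : D != 0 ->
    N ^+ 2 - (B + T ^+ 2) * N + E = 0 ->
    T ^+ 3 + (B - 2 * N) * T + D = 0 ->
  [/\ T != 0, N = (T ^+ 3 + B * T + D) / (2 * T)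
    & root (resolvent B E D) (T ^+ 2)].
Proof.
move=> Dn0 eqN eqT.
have Tn0 : T != 0.
  by apply: contraNneq Dn0 => T0; apply/eqP; rewrite T0 in eqT; lra.
split=> //; first by rewrite -[_ + D](_ : N * (2 * T) = _) ?mulfK; lra.
rewrite root_resolvent; apply/eqP.
have DE : D = 2 * N * T - T ^+ 3 - B * T by lra.
have EE : E = (B + T ^+ 2) * N - N ^+ 2 by lra.
by rewrite DE EE; ring.
Qed.

End System.

(** * Positive roots of the resolvent cubic *)

Section PositiveRoots.
Variable R : realType.
Implicit Types B E D z w p q : R.

(** The coefficients of the resolvent are those of the product of ['X - z] and
    ['X^2 + p *: 'X + q%:P]. *)
Definition resolvent_factored B E D z p q :=
  [/\ 2 * B = p - z, B ^+ 2 - 4 * E = q - p * z & D ^+ 2 = q * z].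

Lemma root_resolvent_factored B E D z : z != 0 -> root (resolvent B E D) z ->
  resolvent_factored B E D z (2 * B + z) (D ^+ 2 / z).
Proof.
rewrite root_resolvent => zn0 /eqP rz; split; [lra| |by rewrite divfK].
by apply: (mulIf zn0); rewrite [RHS]mulrBl divfK //; lra.
Qed.

Lemma factored_root B E D z p q w : resolvent_factored B E D z p q ->
  root (resolvent B E D) w = (w == z) || (w ^+ 2 + p * w + q == 0).
Proof.
case=> B2 BE D2; rewrite root_resolvent B2 BE D2 -[w == z]subr_eq0 -mulf_eq0.
by congr (_ == 0); ring.
Qed.

(** The quantity under the power in [F1] and [F2] is [9 / 4] times the squared
    distance of the critical points of the cubic; in terms of the roots it is
    half the sum of their squared differences. *)
Lemma factored_critical B E D z p q : resolvent_factored B E D z p q ->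
  B ^+ 2 + 12 * E = p ^+ 2 + p * z + z ^+ 2 - 3 * q.
Proof.
case=> B2 BE _; have BH : B = (p - z) / 2 by lra.
by rewrite BH in BE *; lra.
Qed.

Lemma sqr_powR32 (a : R) : 0 <= a -> (a `^ (3 / 2)) ^+ 2 = a ^+ 3.
Proof.
move=> a0; rewrite -powR_mulrn ?powR_ge0 // -powRrM -powR_mulrn //.
by congr (_ `^ _); field.
Qed.

Lemma F2_le_F1 B E D : F2 B E D <= F1 B E D.
Proof. by have := powR_ge0 (B ^+ 2 + 12 * E) (3 / 2); rewrite /F1 /F2; lra. Qed.

(** [F1] and [F2] are conjugate, [g + h] and [g - h] with [27 * h] twice the
    power, so only the square of the power, a polynomial, enters their product. *)
Lemma F1F2_discriminant B E D z p q : resolvent_factored B E D z p q ->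
    0 <= B ^+ 2 + 12 * E ->
  27 * (F1 B E D * F2 B E D) =
    - ((p ^+ 2 - 4 * q) * (z ^+ 2 + p * z + q) ^+ 2).
Proof.
move=> fac /sqr_powR32 hE; case: (fac) => B2 BE D2.
have BH : B = (p - z) / 2 by lra.
have EH : E = (B ^+ 2 - (q - p * z)) / 4 by lra.
rewrite /F1 /F2 D2.
set h := (_ `^ _) in hE *.
have -> : 27 * (((- 2 * B ^+ 3 + 2 * h) / 27 + 8 * E * B / 3 - q * z) *
    ((- 2 * B ^+ 3 - 2 * h) / 27 + 8 * E * B / 3 - q * z)) =
  27 * (- 2 * B ^+ 3 / 27 + 8 * E * B / 3 - q * z) ^+ 2 - 4 / 27 * h ^+ 2.
  by field.
by rewrite hE (factored_critical fac) EH BH; field.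
Qed.

Lemma positive_rootsI (r : {poly R}) (s : seq R) :
    uniq s -> all (fun w => 0 < w) s -> (forall w, root r w = (w \in s)) ->
  positive_roots r s.
Proof.
move=> us /allP s0 rs; split=> // w; rewrite rs.
by case: (boolP (w \in s)) => [/s0 ->|_]; rewrite ?andbF.
Qed.

(** Two further real roots have the same sign, and [B < 0 < B ^+ 2 - 4 * E]
    excludes that both are negative: for [0 <= p] it would give [p < z] and
    [p * z < q], so [4 * p ^+ 2 < 4 * q], against [4 * q <= p ^+ 2]. *)
Lemma factored_p_lt0 B E D z p q : resolvent_factored B E D z p q ->
  0 < z -> 0 < q -> B < 0 -> 0 < B ^+ 2 - 4 * E -> 4 * q <= p ^+ 2 -> p < 0.
Proof.
case=> B2 BE _ z0 q0 Blt0; rewrite BE subr_gt0 => pz disc.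
rewrite ltNge; apply/negP => p0.
have pltz : p < z by lra.
have := ler_wpM2l p0 (ltW pltz); rewrite -expr2 => ppz.
by lra.
Qed.

(** A second positive root [w] forces the third one, [v = q / w], to be positive
    as well, so the signs of the elementary symmetric functions of [z], [w], [v]
    exclude (ii) and (iii), their squared differences exclude (i), and the
    discriminant, a square, excludes (iv) and (v). *)
Lemma positive_roots1 B E D z p q : resolvent_factored B E D z p q ->
  0 < z -> 0 < q -> Case1 B E D -> positive_roots (resolvent B E D) [:: z].
Proof.
move=> fac z0 q0 case1; split=> // w; rewrite mem_seq1 (factored_root w fac).
have [-> | wz] /= := eqVneq w z; first by rewrite z0.
apply/esym/andP=> -[w0 /eqP quad].
pose v := q / w; have v0 : 0 < v by rewrite divr_gt0.
have qE : q = w * v by rewrite /v mulrC divfK ?gt_eqF.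
have pE : p = - (w + v).
  by apply: (mulIf (lt0r_neq0 w0)); rewrite qE in quad; lra.
case: (fac) => B2 BE _; have crit := factored_critical fac.
have discF := F1F2_discriminant fac; have F21 := F2_le_F1 B E D.
move: B2 BE crit discF; rewrite pE qE => B2 BE crit discF.
have wv0 : 0 < w * v by rewrite mulr_gt0.
have wz0 : 0 < w * z by rewrite mulr_gt0.
have vz0 : 0 < v * z by rewrite mulr_gt0.
have FF_le0 : 0 < B ^+ 2 + 12 * E -> F1 B E D * F2 B E D <= 0.
  move=> /ltW/discF dE; rewrite -(pmulr_rle0 _ (_ : 0 < 27)) ?ltr0n // dE.
  rewrite oppr_le0 mulr_ge0 ?sqr_ge0 //.
  by have := sqr_ge0 (w - v); lra.
case: case1 => [i | [[_ ii] | [[_ iii] | [[a0 _ _ iv] | [a0 _ _ v']]]]].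
- have wz2 : 0 < (w - z) ^+ 2 by rewrite exprn_even_gt0 ?subr_eq0.
  have := sqr_ge0 (w - v); have := sqr_ge0 (v - z).
  by lra.
- by lra.
- by lra.
- have := FF_le0 a0; rewrite nmulr_rle0 //.
  by lra.
- have := FF_le0 a0; rewrite pmulr_lle0 //.
  by lra.
Qed.

(** The discriminant vanishes: either the other two roots coincide, or one of
    them is [z] again.  Both at once would make the root triple, and then
    [B ^+ 2 + 12 * E] would be [0]. *)
Lemma positive_roots2 B E D z p q : resolvent_factored B E D z p q ->
    0 < z -> 0 < q -> Case2 B E D ->
  exists w, positive_roots (resolvent B E D) [:: z; w].
Proof.
move=> fac z0 q0 case2.
have [a0 B0 BE0 FF0] : [/\ 0 < B ^+ 2 + 12 * E, B < 0, 0 < B ^+ 2 - 4 * E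
    & F1 B E D * F2 B E D = 0].
  by case: case2 => -[a0 B0 BE0 ->]; split; rewrite ?mul0r ?mulr0.
have /eqP := F1F2_discriminant fac (ltW a0).
rewrite FF0 mulr0 eq_sym oppr_eq0 mulf_eq0 sqrf_eq0.
rewrite (factored_critical fac) in a0.
move=> /orP[/eqP double | /eqP rz].
- have p0 : p < 0 by apply: (factored_p_lt0 fac) => //; lra.
  have pE : p = - 2 * (- p / 2) by field.
  have qE : q = (- p / 2) ^+ 2 by lra.
  exists (- p / 2); move: (- p / 2) pE qE => w pE qE.
  apply: positive_rootsI => [|/=|y].
  + rewrite /= inE andbT; apply: contraTneq a0 => zw.
    by rewrite pE qE zw -leNgt; lra.
  + by rewrite z0 /= andbT; lra.
  + rewrite !inE (factored_root y fac) -(subr_eq0 y w) -(sqrf_eq0 (y - w)).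
    by congr (_ || (_ == 0)); rewrite pE qE; ring.
- pose w := q / z; have w0 : 0 < w by rewrite divr_gt0.
  have qE : q = z * w by rewrite /w mulrC divfK ?gt_eqF.
  have pE : p = - (z + w).
    by apply: (mulIf (lt0r_neq0 z0)); rewrite qE in rz; lra.
  exists w; apply: positive_rootsI => [|/=|y].
  + rewrite /= inE andbT; apply: contraTneq a0 => zw.
    by rewrite pE qE -zw -leNgt; lra.
  + by rewrite z0 w0.
  + rewrite !inE (factored_root y fac).
    have -> : y ^+ 2 + p * y + q = (y - z) * (y - w) by rewrite pE qE; ring.
    by rewrite mulf_eq0 !subr_eq0 orbA orbb.
Qed.

Lemma positive_roots3 B E D z p q : resolvent_factored B E D z p q ->
    0 < z -> 0 < q -> Case3 B E D ->
  exists w v, positive_roots (resolvent B E D) [:: z; w; v].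
Proof.
move=> fac z0 q0 [a0 B0 BE0 /andP[F20 F10]].
have : 0 < (p ^+ 2 - 4 * q) * (z ^+ 2 + p * z + q) ^+ 2.
  rewrite -oppr_lt0 -(F1F2_discriminant fac (ltW a0)).
  by rewrite pmulr_rlt0 ?ltr0n // pmulr_rlt0.
have [-> | rz] := eqVneq (z ^+ 2 + p * z + q) 0.
  by rewrite expr0n mulr0 ltxx.
rewrite pmulr_lgt0 ?exprn_even_gt0 // => disc.
have p0 : p < 0 by apply: (factored_p_lt0 fac) => //; lra.
have s0 : 0 < Num.sqrt (p ^+ 2 - 4 * q) by rewrite sqrtr_gt0.
have s2 := sqr_sqrtr (ltW disc).
move: (Num.sqrt _) s0 s2 => s s0 s2.
pose w := (- p + s) / 2; pose v := (- p - s) / 2.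
have pE : p = - (w + v) by rewrite /w /v; field.
have qE : q = w * v by rewrite /w /v; lra.
have w0 : 0 < w by rewrite /w; lra.
have v0 : 0 < v by rewrite -(pmulr_rgt0 _ w0) -qE.
have wv : w != v by apply/eqP; rewrite /w /v => wv; lra.
have quadE y : y ^+ 2 + p * y + q = (y - w) * (y - v) by rewrite pE qE; ring.
exists w, v; apply: positive_rootsI => [|/=|y].
- rewrite quadE mulf_eq0 !subr_eq0 in rz.
  by rewrite /= !inE rz wv.
- by rewrite z0 w0 v0.
- by rewrite !inE (factored_root y fac) quadE mulf_eq0 !subr_eq0.
Qed.

End PositiveRoots.

Theorem theorem3p2 (R : realType) (b c x : split_quat R)
  (b_pure : sq0 b = 0) (b_neq0 : b != 0)
  (x_sol : x ^+ 2 + b * x + c = 0)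
  (x_reg : sq0 x ^+ 2 != sq_M b / 4) :
  let B := 2 * sq_dot 1 c + sq_I b in
  let E := sq_I c in
  let D := 2 * sq_dot b c in
  exists T N : R,
    [/\ T%:A + b \is a GRing.unit,
        x = (T%:A + b)^-1 * (N%:A - c)
      & [/\ D = 0 ->
            [\/
                [/\ 0 <= B ^+ 2 - 4 * E, T = 0
                  & N = (B + Num.sqrt (B ^+ 2 - 4 * E)) / 2 \/
                    N = (B - Num.sqrt (B ^+ 2 - 4 * E)) / 2],
               
                [/\ 0 <= E, 0 <= - 2 * Num.sqrt E - B
                  & ((T = Num.sqrt (- 2 * Num.sqrt E - B) \/
                      T = - Num.sqrt (- 2 * Num.sqrt E - B)) /\
                     N = - Num.sqrt E) \/
                    ((T = Num.sqrt (2 * Num.sqrt E - B) \/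
                      T = - Num.sqrt (2 * Num.sqrt E - B)) /\
                     N = Num.sqrt E)]
              |
                [/\ 0 < E, 0 <= 2 * Num.sqrt E - B,
                    - 2 * Num.sqrt E - B < 0
                  & (T = Num.sqrt (2 * Num.sqrt E - B) \/
                     T = - Num.sqrt (2 * Num.sqrt E - B)) /\
                    N = Num.sqrt E]],
           
            D != 0 -> Case1 B E D ->
            exists z : R,
              [/\ positive_roots (resolvent B E D) [:: z],
                  T = Num.sqrt z \/ T = - Num.sqrt z
                & N = (T ^+ 3 + B * T + D) / (2 * T)],
           
            D != 0 -> Case2 B E D ->
            exists z1 z2 : R,
              [/\ positive_roots (resolvent B E D) [:: z1; z2],
                  exists2 z, z \in [:: z1; z2] &
                    T = Num.sqrt z \/ T = - Num.sqrt z
                & N = (T ^+ 3 + B * T + D) / (2 * T)]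
          &
            D != 0 -> Case3 B E D ->
            exists z1 z2 z3 : R,
              [/\ positive_roots (resolvent B E D) [:: z1; z2; z3],
                  exists2 z, z \in [:: z1; z2; z3] &
                    T = Num.sqrt z \/ T = - Num.sqrt z
                & N = (T ^+ 3 + B * T + D) / (2 * T)]]].
Proof.
move=> B E D.
have [eqN eqT] := trace_norm_system b_pure x_sol.
have lin := sq_linearized x_sol.
exists (2 * sq0 x), (sq_I x).
have unitTb : (2 * sq0 x)%:A + b \is a GRing.unit.
  rewrite -[_ \is a _]/(sq_I _ != 0) sq_I_add_pure // subr_eq0.
  by apply: contraNneq x_reg => <-; apply/eqP; field.
split=> //; first by rewrite -lin mulKr.
move: (2 * sq0 x) (sq_I x) eqN eqT => T N; rewrite -/B -/E -/D.
move: B E D => B E D eqN eqT {lin unitTb}.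
split=> [D0 | Dn0 | Dn0 | Dn0].
- by apply: system_degenerate => //; rewrite D0 addr0 in eqT.
all: have [Tn0 NE rT] := system_resolvent Dn0 eqN eqT.
all: have z0 : 0 < T ^+ 2 by rewrite exprn_even_gt0.
all: have fac := root_resolvent_factored (lt0r_neq0 z0) rT.
all: have q0 : 0 < D ^+ 2 / T ^+ 2 by rewrite divr_gt0 // exprn_even_gt0.
all: have TE := sqr_eq_sqrt (erefl (T ^+ 2)).
- by move=> /(positive_roots1 fac z0 q0) ?; exists (T ^+ 2).
- move=> /(positive_roots2 fac z0 q0)[w ?]; exists (T ^+ 2), w.
  by split=> //; exists (T ^+ 2); rewrite ?mem_head.
- move=> /(positive_roots3 fac z0 q0)[w [v ?]]; exists (T ^+ 2), w, v.
  by split=> //; exists (T ^+ 2); rewrite ?mem_head.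
Qed.
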